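(* Let $d\ge 2$, $\eta>0$, $n\ge 1$, and let $u_1^{(1)},\ldots,u_n^{(1)}\in S^{d-1}$ be arbitrary initial opinions. Let $v^{(1)},v^{(2)},\ldots$ be i.i.d. random interventions, each uniformly distributed on $S^{d-1}$, and let $u_i^{(t+1)}=f(u_i^{(t)},v^{(t)})$ for all $1\le i\le n$ and $t\ge 1$. Then for any $1\le i<j\le n$, as $t\to\infty$, $$\Pr\left[\ \|u_i^{(t)}-u_j^{(t)}\|\to 0\ \lor\ \|u_i^{(t)}+u_j^{(t)}\|\to 0\ \right]=1 .$$
   Context: $S^{d-1}$ is the Euclidean unit sphere in $\mathbb{R}^d$, $\langle\cdot,\cdot\rangle$ the standard inner product, $\|\cdot\|$ the Euclidean norm. For a fixed parameter $\eta>0$, applying an intervention $v\in S^{d-1}$ to an opinion $u\in S^{d-1}$ gives the updated opinion $f(u,v)=w/\|w\|$, where $w=u+\eta\langle u,v\rangle v$ (here $\|w\|^2=1+(2\eta+\eta^2)\langle u,v\rangle^2\ge 1$, so $f(u,v)$ is well defined). At each time step the same intervention $v^{(t)}$ is applied to all opinions. *)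

(* Defs.v *)
From mathcomp Require Import all_boot all_order all_algebra finmap.
From mathcomp Require Import all_classical all_reals all_analysis.

Set Implicit Arguments.
Unset Strict Implicit.
Unset Printing Implicit Defensive.

Import Order.TTheory GRing.Theory Num.Theory.
Import numFieldNormedType.Exports.

Local Open Scope classical_set_scope.
Local Open Scope ring_scope.

Definition dotp (R : realType) (d : nat) (u v : 'rV[R]_d) : R :=
  \sum_(k < d) u ord0 k * v ord0 k.

(* The library norm `|u| on row vectors is the sup norm. *)
Definition enorm (R : realType) (d : nat) (u : 'rV[R]_d) : R :=
  Num.sqrt (dotp u u).

Definition sphere (R : realType) (d : nat) : set 'rV[R]_d :=
  [set u | enorm u = 1].

(* R^d with its Borel sigma-algebra (matrices carry the product topology). *)
Definition borel_rV (R : realType) (d : nat) :=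
  g_sigma_algebraType (@open 'rV[R]_d).

(* The uniform distribution on the sphere is the (unique) Borel probability
   measure on it that is invariant under the orthogonal group; it is regarded
   here as a measure on R^d concentrated on the sphere. *)
Definition uniform_sphere (R : realType) (d : nat)
    (mu : probability (borel_rV R d) R) : Prop :=
  mu (@sphere R d) = 1%E /\
  forall Q : 'M[R]_d, Q *m Q^T = 1%:M ->
  forall A : set (borel_rV R d), measurable A ->
    mu [set x : borel_rV R d | A ((x : 'rV[R]_d) *m Q)] = mu A.

Definition mutually_independent (R : realType) (dT dE : measure_display)
    (T : measurableType dT) (E : measurableType dE) (P : probability T R)
    (X : nat -> {RV P >-> E}) : Prop :=
  forall (J : {fset nat}) (A : nat -> set E),
    (forall t, measurable (A t)) ->
    P (\bigcap_(t in [set` J]) (X t @^-1` A t)) =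
    (\prod_(t <- J) P (X t @^-1` A t))%E.

Definition identically_distributed (R : realType) (dT dE : measure_display)
    (T : measurableType dT) (E : measurableType dE) (P : probability T R)
    (X : nat -> {RV P >-> E}) : Prop :=
  forall (s t : nat) (A : set E), measurable A ->
    distribution P (X s) A = distribution P (X t) A.

Definition iid (R : realType) (dT dE : measure_display)
    (T : measurableType dT) (E : measurableType dE) (P : probability T R)
    (X : nat -> {RV P >-> E}) : Prop :=
  mutually_independent X /\ identically_distributed X.

Definition update (R : realType) (d : nat) (eta : R) (u v : 'rV[R]_d) :
    'rV[R]_d :=
  let w := u + (eta * dotp u v) *: v in (enorm w)^-1 *: w.

(* Times are counted from 0: the state at time 0 is the initial opinion, and
   the intervention v t leads from time t to time t.+1. *)
Fixpoint opinion (R : realType) (d : nat) (eta : R) (u0 : 'rV[R]_d)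
    (v : nat -> 'rV[R]_d) (t : nat) : 'rV[R]_d :=
  if t is s.+1 then update eta (opinion eta u0 v s) (v s) else u0.

(* Main.v *)
Require Import Defs.
From HB Require Import structures.
From mathcomp Require Import all_boot all_order all_algebra finmap.
From mathcomp Require Import all_classical all_reals all_analysis.
From mathcomp Require Import measurable_realfun ring lra.

Set Implicit Arguments.
Unset Strict Implicit.
Unset Printing Implicit Defensive.

Import Order.TTheory GRing.Theory Num.Theory.
Import numFieldNormedType.Exports.

Local Open Scope classical_set_scope.
Local Open Scope ring_scope.

(* Write G = 1 - <u,v>^2 and k = 2 eta + eta^2. One update by a unit vector x
   multiplies G by
     (1 + k (<u,x>^2 + <g,x>^2)) / ((1 + k <u,x>^2) (1 + k <v,x>^2)),
   where (u, g) is an orthonormal basis of the plane of u and v. By rotation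
   invariance the mean of the logarithm of this factor is a constant -delta,
   independent of the pair, and delta > 0 because
   1 + k (a + b) <= (1 + ka) (1 + kb), strictly when ab <> 0. The logarithm being
   bounded, a second-order expansion of exp gives E[G'^beta] <= rho G^beta with
   rho < 1 for some small beta > 0. Interventions are independent of the past, so
   E[G_t^beta] <= rho^t, the sum of the G_t^beta is almost surely finite and
   G_t -> 0. Once G_t is small the sign of <u_t,v_t> no longer changes, so
   <u_t,v_t> converges to 1 or to -1. *)

(** * Inner product, reflections and orthogonal maps *)

Section InnerProduct.
Context {R : realType} {d : nat}.
Implicit Types u v w f g x : 'rV[R]_d.

Lemma dotpC u v : dotp u v = dotp v u.
Proof. by apply: eq_bigr => k _; rewrite mulrC. Qed.

Lemma dotpDl u v w : dotp (u + v) w = dotp u w + dotp v w.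
Proof. by rewrite -big_split; apply: eq_bigr => k _; rewrite mxE mulrDl. Qed.

Lemma dotpZl a u v : dotp (a *: u) v = a * dotp u v.
Proof. by rewrite mulr_sumr; apply: eq_bigr => k _; rewrite mxE mulrA. Qed.

Lemma dotpDr u v w : dotp w (u + v) = dotp w u + dotp w v.
Proof. by rewrite dotpC dotpDl !(dotpC w). Qed.

Lemma dotpZr a u v : dotp u (a *: v) = a * dotp u v.
Proof. by rewrite dotpC dotpZl dotpC. Qed.

Lemma dotpNl u v : dotp (- u) v = - dotp u v.
Proof. by rewrite -scaleN1r dotpZl mulN1r. Qed.

Lemma dotpNr u v : dotp v (- u) = - dotp v u.
Proof. by rewrite dotpC dotpNl dotpC. Qed.

Definition dotpE := (dotpDl, dotpDr, dotpZl, dotpZr, dotpNl, dotpNr).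

Lemma dotp_ge0 u : 0 <= dotp u u.
Proof. by apply: sumr_ge0 => k _; rewrite -expr2 sqr_ge0. Qed.

Lemma dotp_eq0 u : dotp u u = 0 -> u = 0.
Proof.
move=> /eqP; rewrite psumr_eq0 => [/allP h|k _]; last by rewrite -expr2 sqr_ge0.
apply/rowP => k; have := h k (mem_index_enum _).
by rewrite /= mxE -expr2 sqrf_eq0 => /eqP.
Qed.

Lemma dotp_sqr_le u x : dotp x x = 1 -> dotp u x ^+ 2 <= dotp u u.
Proof.
move=> x1; have := dotp_ge0 (u - dotp u x *: x).
rewrite !dotpE x1 (dotpC x u); lra.
Qed.

Lemma dotp_delta u (k : 'I_d) : dotp u (delta_mx ord0 k) = u ord0 k.
Proof.
rewrite /dotp (bigD1 k) //= mxE !eqxx mulr1 big1 ?addr0 // => l lk.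
by rewrite mxE eqxx (negbTE lk) mulr0.
Qed.

Lemma enorm_sqr u : enorm u ^+ 2 = dotp u u.
Proof. by rewrite sqr_sqrtr // dotp_ge0. Qed.

Lemma sphereP u : sphere u <-> dotp u u = 1.
Proof.
rewrite -enorm_sqr /sphere /=; split=> [->|/eqP]; first by rewrite expr1n.
by rewrite sqrp_eq1 ?sqrtr_ge0 // => /eqP.
Qed.

(* For w = 0 the junk value 2 / 0 = 0 turns the reflection into the identity. *)
Lemma householder w : exists H : 'M[R]_d, [/\ H *m H^T = 1%:M, H^T = H &
  forall x, x *m H = x - (2 * dotp x w / dotp w w) *: w].
Proof.
pose H : 'M[R]_d := 1%:M - (2 / dotp w w) *: (w^T *m w).
have HT : H^T = H by rewrite linearB /= trmx1 linearZ /= trmx_mul trmxK.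
have xH x : x *m H = x - (2 * dotp x w / dotp w w) *: w.
  rewrite mulmxBr mulmx1 -scalemxAr mulmxA; congr (_ - _).
  have -> : x *m w^T = (dotp x w)%:M.
    apply/rowP => k; rewrite !mxE !ord1 eqxx mulr1n.
    by apply: eq_bigr => i _; rewrite mxE.
  by rewrite mul_scalar_mx scalerA; congr (_ *: _); ring.
exists H; split => //; rewrite HT.
apply/row_matrixP => i; rewrite !rowE mulmxA !xH mulmx1.
set x := delta_mx _ _.
have [w0|w0] := eqVneq (dotp w w) 0.
  by rewrite (dotp_eq0 w0) !scaler0 !subr0.
rewrite !dotpE -addrA -opprD -scalerDl.
by rewrite [X in X *: w](_ : _ = 0) ?scale0r ?subr0 //; field.
Qed.

(** The reflection along [f - g] exchanges the unit vectors [f] and [g] and fixes every vector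
    orthogonal to [f - g]; the latter lets a second reflection preserve what a first one arranged.
    For [f = g] it is the identity. *)
Lemma orthogonal_unit f g : dotp f f = 1 -> dotp g g = 1 ->
  exists2 Q : 'M[R]_d, Q *m Q^T = 1%:M &
    forall x, dotp f (x *m Q) = dotp g x /\
      forall y, dotp y f = dotp y g -> dotp y (x *m Q) = dotp y x.
Proof.
move=> f1 g1; have [H [HH HT xH]] := householder (f - g).
exists H => // x; split; last first.
  by move=> y yfg; rewrite xH !dotpE yfg subrr mulr0 oppr0 addr0.
rewrite xH !dotpE f1 g1 (dotpC g f).
have [e|ne] := eqVneq (dotp f g) 1.
  suff -> : f = g by rewrite !(subrr, mulr0, mul0r, subr0).
  apply/eqP; rewrite -subr_eq0; apply/eqP/dotp_eq0.
  by rewrite !dotpE f1 g1 (dotpC g f) e; ring.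
rewrite (dotpC x f) (dotpC x g); field.
rewrite (_ : _ + _ = 2 * (1 - dotp f g)); last by ring.
by rewrite mulf_neq0 // subr_eq0 eq_sym.
Qed.

Lemma dotp_mulmx_orthogonal (Q : 'M[R]_d) u v :
  dotp (u *m Q) v = dotp u (v *m Q^T).
Proof.
have E (y z : 'rV[R]_d) : dotp y z = (y *m z^T) ord0 ord0.
  by rewrite mxE; apply: eq_bigr => k _; rewrite mxE.
by rewrite !E trmx_mul trmxK mulmxA.
Qed.

(** Two reflections: [A] matches [f1] with [g1], then [H] matches [h], the transported [f2], with
    [g2]. Both [h] and [g2] are orthogonal to [g1], so [H] leaves the first match intact. *)
Lemma orthogonal_pair f1 f2 g1 g2 :
  dotp f1 f1 = 1 -> dotp f2 f2 = 1 -> dotp f1 f2 = 0 ->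
  dotp g1 g1 = 1 -> dotp g2 g2 = 1 -> dotp g1 g2 = 0 ->
  exists2 Q : 'M[R]_d, Q *m Q^T = 1%:M &
    forall x, dotp f1 (x *m Q) = dotp g1 x /\ dotp f2 (x *m Q) = dotp g2 x.
Proof.
move=> f11 f22 f12 g11 g22 g12.
have [A AA fA] := orthogonal_unit f11 g11.
have AtA : A^T *m A = 1%:M by apply: mulmx1C.
pose h := f2 *m A^T.
have fh x : dotp f2 (x *m A) = dotp h x.
  by rewrite /h dotp_mulmx_orthogonal trmxK.
have hh : dotp h h = 1 by rewrite -fh /h -mulmxA AtA mulmx1.
have gh : dotp g1 h = 0 by rewrite -(fA _).1 /h -mulmxA AtA mulmx1.
have [H HH hH] := orthogonal_unit hh g22.
exists (H *m A).
  by rewrite trmx_mul mulmxA -(mulmxA H A) AA mulmx1.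
move=> x; rewrite mulmxA (fA _).1 fh (hH _).1; split=> //.
by apply: (hH _).2; rewrite gh g12.
Qed.

End InnerProduct.

(** * One update of a pair: Gram determinant and sign of the inner product *)

Definition gram (R : realType) d (u v : 'rV[R]_d) : R := 1 - dotp u v ^+ 2.

Section UpdateStep.
Context {R : realType} {d : nat} (eta : R) (eta0 : 0 < eta).
Implicit Types u v x : 'rV[R]_d.
(** This is [(1 + eta)^2 - 1], the excess of the squared stretch of [I + eta x x^T] along a unit
    vector [x]. *)
Local Notation kap := (2 * eta + eta ^+ 2).

Lemma kap_gt0 : 0 < kap.
Proof. by rewrite addr_gt0 ?mulr_gt0 ?exprn_gt0. Qed.

Lemma dotp_shift u v x :
  dotp (u + (eta * dotp u x) *: x) (v + (eta * dotp v x) *: x) =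
  dotp u v + (2 * eta + eta ^+ 2 * dotp x x) * (dotp u x * dotp v x).
Proof. by rewrite !dotpE (dotpC x v); ring. Qed.

(** The bound covers arbitrary [x], so that opinions stay on the sphere at every outcome, also on
    the null set where some intervention leaves it. *)
Lemma dotp_shift_ge1 u x : sphere u ->
  1 <= dotp (u + (eta * dotp u x) *: x) (u + (eta * dotp u x) *: x).
Proof.
move/sphereP => u1; rewrite dotp_shift u1 lerDl mulr_ge0 //.
  by rewrite addr_ge0 ?mulr_ge0 ?dotp_ge0 ?sqr_ge0 // ltW.
by rewrite -expr2 sqr_ge0.
Qed.

Lemma update_sphere u x : sphere u -> sphere (update eta u x).
Proof.
move=> u1; apply/sphereP; rewrite /update.
have := dotp_shift_ge1 x u1; set w := u + _ => w1.
rewrite dotpZl dotpZr mulrA -expr2 exprVn enorm_sqr mulVf // gt_eqF //.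
exact: lt_le_trans ltr01 w1.
Qed.

Lemma opinion_sphere u (x : nat -> 'rV[R]_d) t : sphere u ->
  sphere (opinion eta u x t).
Proof. by move=> u1; elim: t => //= t IH; apply: update_sphere. Qed.

Lemma gram_ge0 u v : sphere u -> sphere v -> 0 <= gram u v.
Proof.
by move=> /sphereP u1 /sphereP v1; rewrite subr_ge0 -[leRHS]u1 dotp_sqr_le.
Qed.

Lemma gram_le1 u v : gram u v <= 1.
Proof. by rewrite gerBl sqr_ge0. Qed.

(** [N] is the product of the norms of the two unnormalized updates. The Gram determinant sees only
    its square, the sign of the inner product only its positivity. *)
Lemma dotp_update u v x : sphere u -> sphere v -> sphere x ->
  exists2 N : R, 0 < N &
  N ^+ 2 = (1 + kap * dotp u x ^+ 2) * (1 + kap * dotp v x ^+ 2) /\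
  dotp (update eta u x) (update eta v x) =
    (dotp u v + kap * (dotp u x * dotp v x)) / N.
Proof.
move=> su sv /sphereP x1.
set w := u + (eta * dotp u x) *: x; set z := v + (eta * dotp v x) *: x.
have w0 : 0 < enorm w by rewrite sqrtr_gt0 (lt_le_trans ltr01) ?dotp_shift_ge1.
have z0 : 0 < enorm z by rewrite sqrtr_gt0 (lt_le_trans ltr01) ?dotp_shift_ge1.
exists (enorm w * enorm z); first by rewrite mulr_gt0.
move/sphereP : su => u1; move/sphereP : sv => v1.
split; first by rewrite exprMn !enorm_sqr !dotp_shift u1 v1 x1 !mulr1 -!expr2.
rewrite /update -/w -/z dotpZl dotpZr dotp_shift x1 mulr1 invfM; ring.
Qed.

(* The Gram determinant of the pair is multiplied by the ratio of the squared
   norms of [I + eta x x^T] on the bivector [u /\ v] and on [u] and [v]; g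
   completes u to an orthonormal basis of the plane of u and v. *)
Lemma gram_update u v : sphere u -> sphere v -> 0 < gram u v ->
  exists g : 'rV[R]_d, [/\ dotp g g = 1, dotp u g = 0 &
  forall x, sphere x -> gram (update eta u x) (update eta v x) =
    gram u v * ((1 + kap * (dotp u x ^+ 2 + dotp g x ^+ 2)) /
     ((1 + kap * dotp u x ^+ 2) * (1 + kap * dotp v x ^+ 2)))].
Proof.
move=> su sv G0; set c := dotp u v; set s := Num.sqrt (gram u v).
have u1 := (sphereP u).1 su; have v1 := (sphereP v).1 sv.
have s0 : s != 0 by rewrite gt_eqF // sqrtr_gt0.
have s2 : s ^+ 2 = 1 - c ^+ 2 by rewrite sqr_sqrtr // ltW.
exists (s^-1 *: (v - c *: u)); split.
- rewrite !dotpE u1 v1 (dotpC v u) -/c.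
  by rewrite [LHS](_ : _ = (1 - c ^+ 2) / s ^+ 2) ?s2 ?divff -?s2 ?expf_neq0 //;
     field.
- by rewrite !dotpE u1 -/c; ring.
move=> x sx; have [N N0 [N2 E]] := dotp_update su sv sx.
rewrite /gram E expr_div_n N2 -/c !dotpE.
have a1 : 1 + kap * dotp u x ^+ 2 != 0.
  by rewrite gt_eqF // ltr_pwDl // mulr_ge0 ?sqr_ge0 // ltW // kap_gt0.
have b1 : 1 + kap * dotp v x ^+ 2 != 0.
  by rewrite gt_eqF // ltr_pwDl // mulr_ge0 ?sqr_ge0 // ltW // kap_gt0.
rewrite [(_^-1 * _) ^+ 2]exprMn exprVn s2; field.
by rewrite -s2 expf_neq0 // a1 b1.
Qed.

(** Here [|v - c u|^2 = 1 - c^2 = 0], so [v = c u] with [c^2 = 1], and the update commutes with this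
    sign. *)
Lemma gram_update0 u v x : sphere u -> sphere v -> gram u v = 0 ->
  gram (update eta u x) (update eta v x) = 0.
Proof.
move=> su sv G0.
have u1 := (sphereP u).1 su; have v1 := (sphereP v).1 sv.
set c := dotp u v; have c2 : c ^+ 2 = 1.
  by apply/esym/eqP; rewrite -subr_eq0; apply/eqP.
have vE : v = c *: u.
  apply/eqP; rewrite -subr_eq0; apply/eqP/dotp_eq0.
  rewrite !dotpE u1 v1 (dotpC v u) -/c.
  by move: c2; lra.
have -> : update eta v x = c *: update eta u x.
  rewrite /update vE dotpZl.
  set w := u + _; have -> : c *: u + (eta * (c * dotp u x)) *: x = c *: w.
    by rewrite scalerDr scalerA; congr (_ + _ *: _); ring.
  have -> : enorm (c *: w) = enorm w.
    by rewrite /enorm !dotpE mulrA -expr2 c2 mul1r.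
  by rewrite !scalerA mulrC.
rewrite /gram dotpZr exprMn c2.
have /sphereP -> := update_sphere x su.
by rewrite expr1n mulr1 subrr.
Qed.

(** Times [c = <u,v>], the numerator is [c^2 + k (c a)^2 + k c a e], where [e] pairs [x] with the
    part of [v] orthogonal to [u]. Only the last term can be negative, and [e^2] is at most the Gram
    determinant. *)
Lemma update_same_sign u v x : sphere u -> sphere v -> sphere x ->
  gram u v < (2 * (1 + kap)) ^- 2 ->
  0 < dotp u v * dotp (update eta u x) (update eta v x).
Proof.
move=> su sv sx Gs; have [N N0 [_ ->]] := dotp_update su sv sx.
have u1 := (sphereP u).1 su; have v1 := (sphereP v).1 sv.
have x1 := (sphereP x).1 sx; have k0 := kap_gt0.
set c := dotp u v; set a := dotp u x; set b := dotp v x.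
set k := kap in k0 Gs *.
rewrite mulrA divr_gt0 //.
have a1 : a ^+ 2 <= 1 by rewrite -u1 dotp_sqr_le.
have e2 : (b - c * a) ^+ 2 <= gram u v.
  have := dotp_sqr_le (v - c *: u) x1; rewrite !dotpE u1 v1 (dotpC v u) -/c.
  rewrite -/a -/b => h; rewrite /gram -/c; lra.
set e := b - c * a in e2.
have -> : c * (c + k * (a * b)) = c ^+ 2 + k * (c * a) ^+ 2 + k * (c * a * e).
  by rewrite /e; ring.
(* The threshold is [r^2]. The sum exceeds [1 - r^2 - k r], which is positive since [k r = 1/2 - r]
   and [r <= 1/2]. *)
set r := (2 * (1 + k))^-1; rewrite -exprVn -/r in Gs.
have r0 : 0 < r by rewrite invr_gt0 mulr_gt0 // addr_gt0.
have rk : 2 * r + 2 * k * r = 1.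
  by rewrite /r; field; rewrite gt_eqF // addr_gt0.
have c2 : c ^+ 2 = 1 - gram u v by rewrite /gram -/c; ring.
have er : `|e| < r.
  by rewrite -(ltr_pXn2r (n := 2)) ?nnegrE ?normr_ge0 ?ltW // real_normK ?num_real;
     lra.
have G1 := gram_ge0 su sv.
have ca : `|c * a| <= 1.
  rewrite -(ler_pXn2r (n := 2)) ?nnegrE ?normr_ge0 // real_normK ?num_real //.
  by rewrite expr1n exprMn mulr_ile1 ?sqr_ge0 // c2; lra.
have cae : - r <= c * a * e.
  have : `|c * a * e| <= r.
    by rewrite normrM -[r]mul1r ler_pM ?normr_ge0 // ltW.
  by rewrite ler_norml => /andP[].
have kr0 : 0 < k * r by rewrite mulr_gt0.
have : - (k * r) <= k * (c * a * e) by rewrite -mulrN ler_pM2l.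
have : 0 <= k * (c * a) ^+ 2 by rewrite mulr_ge0 ?sqr_ge0 // ltW.
have : r ^+ 2 <= r * (1 / 2) by rewrite expr2 ler_pM2l //; lra.
rewrite c2; lra.
Qed.

End UpdateStep.

(** * Synchronization from a vanishing Gram determinant *)

Lemma mulr_gt0_trans (R : realDomainType) (p q r : R) :
  0 < p * q -> 0 < q * r -> 0 < p * r.
Proof.
move=> pq qr; have := mulr_gt0 pq qr.
rewrite (_ : p * q * (q * r) = q ^+ 2 * (p * r)); last by ring.
rewrite pmulr_rgt0 // exprn_even_gt0 //=.
by move: pq; apply: contraTneq => ->; rewrite mulr0 ltxx.
Qed.

Lemma gram_cvg0_sync (R : realType) d (eta : R) (u v : 'rV[R]_d)
    (x : nat -> 'rV[R]_d) : 0 < eta -> sphere u -> sphere v ->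
  (forall t, sphere (x t)) ->
  let U t := opinion eta u x t in let V t := opinion eta v x t in
  (fun t => gram (U t) (V t)) @ \oo --> (0 : R) ->
  ((fun t => enorm (U t - V t)) @ \oo --> (0 : R)) \/
  ((fun t => enorm (U t + V t)) @ \oo --> (0 : R)).
Proof.
move=> eta0 su sv sx U V G0.
have sU t : sphere (U t) by exact: opinion_sphere.
have sV t : sphere (V t) by exact: opinion_sphere.
have k0 : 0 < (2 * (1 + (2 * eta + eta ^+ 2))) ^- 2.
  by rewrite invr_gt0 exprn_gt0 // mulr_gt0 // addr_gt0 // kap_gt0.
(* From time [n] on, the Gram determinant is below the threshold of [update_same_sign], and the sign
   of the inner product is frozen. *)
have [n _ hn] : \forall t \near \oo, gram (U t) (V t) <
    (2 * (1 + (2 * eta + eta ^+ 2))) ^- 2.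
  exact: cvgr_lt G0 _ k0.
have step t : (n <= t)%N -> 0 < dotp (U t) (V t) * dotp (U t.+1) (V t.+1).
  by move=> nt; apply: update_same_sign (hn _ nt).
have same t : 0 < dotp (U n) (V n) * dotp (U (n + t)%N) (V (n + t)%N).
  elim: t => [|t IH].
    rewrite addn0 -expr2 exprn_even_gt0 //=.
    by have := step _ (leqnn n); apply: contraTneq => ->; rewrite mul0r ltxx.
  have h := step (n + t)%N (leq_addr _ _); rewrite addnS.
  exact: mulr_gt0_trans IH h.
have S0 : (fun t => Num.sqrt (2 * gram (U t) (V t))) @ \oo --> (0 : R).
  have : (fun t => 2 * gram (U t) (V t)) @ \oo --> (2 * 0 : R).
    exact: cvgM (cvg_cst _) G0.
  rewrite mulr0 -[in X in _ -> X](@sqrtr0 R) => /cvg_comp; apply.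
  exact: sqrt_continuous.
have conv (W : nat -> 'rV[R]_d) :
    (forall t, (n <= t)%N -> dotp (W t) (W t) <= 2 * gram (U t) (V t)) ->
    (fun t => enorm (W t)) @ \oo --> (0 : R).
  move=> h; apply: (squeeze_cvgr _ (cvg_cst 0) S0).
  exists n => // t /= nt; rewrite sqrtr_ge0 /= ler_wsqrtr //; exact: h.
have [cn|cn] := ltP 0 (dotp (U n) (V n)); [left|right]; apply: conv => t nt;
  move: (same (t - n)%N); rewrite subnKC // => h;
  have /sphereP Ut := sU t; have /sphereP Vt := sV t;
  have Gt := gram_ge0 (sU t) (sV t); rewrite /gram in Gt *;
  rewrite !dotpE Ut Vt (dotpC (V t)).
- rewrite pmulr_rgt0 // in h; set c := dotp (U t) (V t) in h Gt *.
  have : c <= 1 by nra.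
  rewrite -(ler_pM2l h); lra.
- have h' : dotp (U t) (V t) < 0.
    by rewrite ltNge; apply/negP => h2; move: h; rewrite ltNge mulr_le0_ge0.
  set c := dotp (U t) (V t) in h' Gt *.
  have c0 : 0 < - c by rewrite oppr_gt0.
  have : - c <= 1 by nra.
  rewrite -(ler_pM2l c0); lra.
Qed.

(** * Elementary inequalities for the exponential and the logarithm *)

Lemma expR_le_quadratic (R : realType) (y : R) : y <= 2^-1 ->
  expR y <= 1 + y + 2 * y ^+ 2.
Proof.
move=> y2; have y1 : 0 < 1 - y by lra.
have h : 1 - y <= expR (- y) by have := @expR_ge1Dx R (- y).
have p0 : 0 < 1 + y + 2 * y ^+ 2 by have := sqr_ge0 (y + 4^-1); lra.
rewrite -[expR y]invrK -expRN invf_ple ?posrE ?expR_gt0 //.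
apply: le_trans h; rewrite -div1r ler_pdivrMr //.
(* It remains to expand [(1 - y) (1 + y + 2 y^2) = 1 + y^2 (1 - 2 y)]. *)
have : 0 <= y ^+ 2 * (1 - 2 * y) by rewrite mulr_ge0 ?sqr_ge0 //; lra.
lra.
Qed.

Section LogRatio.
Context {R : realType} (k : R) (k0 : 0 < k).
Local Notation L h := (ln (1 + k * h)).

Lemma add1M_gt0 h : 0 <= h -> 0 < 1 + k * h.
Proof. by move=> h0; rewrite ltr_pwDl // mulr_ge0 // ltW. Qed.

Lemma ln1M_ge0 h : 0 <= h -> 0 <= L h.
Proof. by move=> h0; rewrite ln_ge0 // lerDl mulr_ge0 // ltW. Qed.

Lemma ln1M_le h h' : 0 <= h -> h <= h' -> L h <= L h'.
Proof.
move=> h0 hh; rewrite ler_ln ?posrE ?add1M_gt0 ?(le_trans h0) //.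
by rewrite lerD2l ler_pM2l.
Qed.

(** The power is [exp (beta X)] with [X = L p - L a - L b] and [|X| <= 2 L 2], so the quadratic
    bound applies. The negative logarithms are moved to the left so that only nonnegative functions
    get integrated. *)
Lemma powR_ratio_le (a b p beta : R) : 0 <= a <= 1 -> 0 <= b <= 1 ->
  0 <= p <= 2 -> 0 <= beta -> beta * (2 * L 2) <= 2^-1 ->
  ((1 + k * p) / ((1 + k * a) * (1 + k * b))) `^ beta + (beta * L a + beta * L b)
   <= 1 + 2 * (beta * (2 * L 2)) ^+ 2 + beta * L p.
Proof.
move=> /andP[a0 a1] /andP[b0 b1] /andP[p0 p2] be0 bC.
rewrite /powR gt_eqF; last by rewrite divr_gt0 ?mulr_gt0 ?add1M_gt0.
rewrite ln_div ?posrE ?mulr_gt0 ?add1M_gt0 // lnM ?posrE ?add1M_gt0 //.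
have := ln1M_ge0 a0; have := ln1M_ge0 b0; have := ln1M_ge0 p0.
have := ln1M_le p0 p2.
have : L a <= L 2 by apply: ln1M_le; lra.
have : L b <= L 2 by apply: ln1M_le; lra.
move: (L a) (L b) (L p) (L 2) bC => la lb lp C bC lb2 la2 lp2 lp0 lb0 la0.
set X := lp - (la + lb); have XC : `|X| <= 2 * C.
  by rewrite /X ler_norml; apply/andP; split; lra.
have bX : `|beta * X| <= beta * (2 * C).
  by rewrite normrM (ger0_norm be0) ler_wpM2l.
have X2 : (beta * X) ^+ 2 <= (beta * (2 * C)) ^+ 2.
  by rewrite -real_normK ?num_real // ler_pXn2r ?nnegrE // (le_trans _ bX).
have bX2 : beta * X <= 2^-1 by rewrite (le_trans (ler_norm _)) // (le_trans bX).
have := expR_le_quadratic bX2; rewrite -/X.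
have : beta * X = beta * lp - beta * la - beta * lb by rewrite /X; ring.
lra.
Qed.

(** The product [(1 + k a) (1 + k b)] exceeds [1 + k (a + b)] by exactly [k^2 a b]; this also
    settles the equality case below. *)
Lemma ln1MD_le a b : 0 <= a -> 0 <= b -> L (a + b) <= L a + L b.
Proof.
move=> a0 b0; rewrite -lnM ?posrE ?add1M_gt0 //.
rewrite ler_ln ?posrE ?mulr_gt0 ?add1M_gt0 ?addr_ge0 //.
by have := mulr_ge0 (sqr_ge0 k) (mulr_ge0 a0 b0); nra.
Qed.

Lemma ln1MD_eq a b : 0 <= a -> 0 <= b -> L (a + b) = L a + L b -> a * b = 0.
Proof.
move=> a0 b0; rewrite -lnM ?posrE ?add1M_gt0 // => /ln_inj.
rewrite !posrE ?mulr_gt0 ?add1M_gt0 ?addr_ge0 //.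
move=> /(_ isT isT) h.
have /eqP : k ^+ 2 * (a * b) = 0 by lra.
by rewrite mulf_eq0 expf_eq0 gt_eqF //= => /eqP.
Qed.
End LogRatio.

(** * Measurability of vector-valued maps, coordinate by coordinate *)

Definition coord_measurable (R : realType) n dT (T : measurableType dT)
    (f : T -> 'rV[R]_n) :=
  forall k, measurable_fun setT (fun w => f w ord0 k).

Section CoordMeasurable.
Context {R : realType} {n : nat} {dT : measure_display} {T : measurableType dT}.
Implicit Types (f g x : T -> 'rV[R]_n).

(** Coordinates are continuous, hence Borel. This is the passage from Borel random vectors to
    real-valued measurability, where the rest of the work is done. *)
Lemma coord_measurable_borel (f : T -> borel_rV R n) :
  measurable_fun setT f -> coord_measurable (f : T -> 'rV[R]_n).
Proof.
move=> mf k.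
have mk : measurable_fun [set: borel_rV R n]
    (fun y : borel_rV R n => (y : 'rV[R]_n) ord0 k).
  apply: (measurability _ (RGenOpens.measurableE R)).
  move=> _ [_ [a [b ->] <-]]; rewrite setTI; apply: sub_sigma_algebra.
  apply: open_comp; last exact: interval_open.
  by move=> y _; exact: coord_continuous.
exact: measurableT_comp mk mf.
Qed.

Lemma measurable_dotp f g : coord_measurable f -> coord_measurable g ->
  measurable_fun setT (fun w => dotp (f w) (g w)).
Proof.
move=> mf mg; apply: measurable_sum => k.
by apply: measurable_funM; [exact: mf|exact: mg].
Qed.

Lemma coord_measurableD f g : coord_measurable f -> coord_measurable g ->
  coord_measurable (fun w => f w + g w).
Proof.
move=> mf mg k; apply: (eq_measurable_fun (fun w => f w ord0 k + g w ord0 k)).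
  by move=> w _; rewrite mxE.
by apply: measurable_funD; [exact: mf|exact: mg].
Qed.

Lemma coord_measurableZ (a : T -> R) f : measurable_fun setT a ->
  coord_measurable f -> coord_measurable (fun w => a w *: f w).
Proof.
move=> ma mf k; apply: (eq_measurable_fun (fun w => a w * f w ord0 k)).
  by move=> w _; rewrite mxE.
by apply: measurable_funM => //; exact: mf.
Qed.

Lemma coord_measurable_cst (u : 'rV[R]_n) :
  coord_measurable (fun _ : T => u).
Proof. by move=> k; exact: measurable_cst. Qed.

Lemma measurable_enorm f : coord_measurable f ->
  measurable_fun setT (fun w => enorm (f w)).
Proof.
move=> mf; apply: (measurableT_comp _ (measurable_dotp mf mf)).
by apply: continuous_measurable_fun; exact: sqrt_continuous.
Qed.

Lemma coord_measurable_update eta f x : coord_measurable f ->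
  coord_measurable x -> coord_measurable (fun w => update eta (f w) (x w)).
Proof.
move=> mf mx; rewrite /update.
have mw : coord_measurable (fun w => f w + (eta * dotp (f w) (x w)) *: x w).
  apply: coord_measurableD => //; apply: coord_measurableZ => //.
  by apply: measurable_funM => //; exact: measurable_dotp.
apply: coord_measurableZ => //.
(* The inverse of the norm is rewritten as a real power, a measurable function that agrees with it
   on nonnegative reals. *)
apply: (eq_measurable_fun (fun w =>
    enorm (f w + (eta * dotp (f w) (x w)) *: x w) `^ (- 1))).
  by move=> w _; rewrite powR_inv1 // sqrtr_ge0.
exact: (measurableT_comp (measurable_powR _) (measurable_enorm mw)).
Qed.

Lemma measurable_gram f g : coord_measurable f -> coord_measurable g ->
  measurable_fun setT (fun w => gram (f w) (g w)).
Proof.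
move=> mf mg; apply: measurable_funB => //.
by apply: measurable_funX; exact: measurable_dotp.
Qed.

Lemma measurable_cvg0 (h : nat -> T -> R) :
  (forall t, measurable_fun setT (h t)) ->
  measurable [set w | (fun t => h t w) @ \oo --> (0 : R)].
Proof.
move=> mh.
(* Restricting the tolerances to [1 / (m + 1)] makes all three quantifiers of convergence
   countable. *)
have -> : [set w | (fun t => h t w) @ \oo --> (0 : R)] =
    \bigcap_m \bigcup_N \bigcap_t
      [set w | (N <= t)%N -> `|h t w| < m.+1%:R^-1].
  apply/seteqP; split=> w /=.
    move=> h0 m _.
    have [N _ hN] : \forall t \near \oo, `|0 - h t w| < m.+1%:R^-1.
      by move/cvgrPdist_lt : h0; apply; rewrite invr_gt0.
    by exists N => // t _ /= Nt; have := hN _ Nt; rewrite sub0r normrN.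
  move=> hw; apply/cvgrPdist_lt => e e0.
  have [m me] : exists m : nat, m.+1%:R^-1 < e.
    exists (Num.trunc e^-1); rewrite invf_plt ?posrE //.
    by rewrite truncnS_gt.
  have [N _ hN] := hw m I; exists N => // t /= Nt.
  by rewrite sub0r normrN (lt_trans _ me) //; exact: hN.
apply: bigcapT_measurable => m; apply: bigcupT_measurable => N.
apply: bigcapT_measurable => t; have [Nt|tN] := leqP N t; last first.
  by rewrite (_ : [set w | _] = setT) // -subTset => w _ /=.
rewrite (_ : [set w | _] = (fun w => `|h t w|) @^-1` `]-oo, m.+1%:R^-1[%classic).
  rewrite -[X in measurable X]setTI.
  exact: (measurableT_comp (@normr_measurable R setT) (mh t)).
by apply/seteqP; split => w /=; rewrite in_itv //= => ->.
Qed.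
End CoordMeasurable.

(** * Integrals of nonnegative functions under a probability *)

Section ProbabilityIntegrals.
Context {R : realType} {dX : measure_display} {X : measurableType dX}.
Context (mu : probability X R).
Implicit Types h : X -> R.

Lemma ge0_integral_affine h (a c m : R) : 0 <= a -> 0 <= c ->
  (forall x, 0 <= h x) -> measurable_fun setT h ->
  (\int[mu]_x (h x)%:E = m%:E)%E ->
  (\int[mu]_x (c + a * h x)%:E = (c + a * m)%:E)%E.
Proof.
move=> a0 c0 h0 mh hm.
have mE : measurable_fun setT (EFin \o h) by exact/measurable_EFinP.
transitivity (\int[mu]_x (cst c%:E x + a%:E * (h x)%:E))%E.
  by apply: eq_integral => x _; rewrite EFinD EFinM.
rewrite ge0_integralD //; last 2 first.
- by move=> x _; rewrite -EFinM lee_fin mulr_ge0.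
- by apply/measurable_EFinP; exact: measurable_funM.
rewrite integral_cst // ge0_integralZl //; last first.
  by move=> x _; rewrite lee_fin.
rewrite hm [X in (_ * X + _)%E](_ : _ = 1%E) ?mule1 //.
exact: probability_setT.
Qed.

Lemma ge0_integralD_fin h1 h2 (m1 m2 : R) :
  (forall x, 0 <= h1 x) -> (forall x, 0 <= h2 x) ->
  measurable_fun setT h1 -> measurable_fun setT h2 ->
  (\int[mu]_x (h1 x)%:E = m1%:E)%E -> (\int[mu]_x (h2 x)%:E = m2%:E)%E ->
  (\int[mu]_x (h1 x + h2 x)%:E = (m1 + m2)%:E)%E.
Proof.
move=> h10 h20 mh1 mh2 E1 E2; rewrite EFinD -E1 -E2.
have m1E : measurable_fun setT (EFin \o h1) by exact/measurable_EFinP.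
have m2E : measurable_fun setT (EFin \o h2) by exact/measurable_EFinP.
rewrite -ge0_integralD //; by move=> x _; rewrite lee_fin.
Qed.

(** The inequality is integrated with all terms nonnegative; the subtraction takes place between the
    finite values [a] and [b]. *)
Lemma ae_integral_leB h (l p : X -> R) (a b : R) :
  (forall x, 0 <= h x) -> (forall x, 0 <= l x) -> (forall x, 0 <= p x) ->
  measurable_fun setT h -> measurable_fun setT l -> measurable_fun setT p ->
  {ae mu, forall x, h x + l x <= p x} ->
  (\int[mu]_x (l x)%:E = a%:E)%E -> (\int[mu]_x (p x)%:E = b%:E)%E ->
  (\int[mu]_x (h x)%:E <= (b - a)%:E)%E.
Proof.
move=> h0 l0 p0 mh ml mp hlp la pb.
have mhE : measurable_fun setT (EFin \o h) by exact/measurable_EFinP.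
have mlE : measurable_fun setT (EFin \o l) by exact/measurable_EFinP.
have mpE : measurable_fun setT (EFin \o p) by exact/measurable_EFinP.
rewrite EFinB leeBrDr // -la -pb -ge0_integralD //; last 2 first.
- by move=> x _; rewrite lee_fin.
- by move=> x _; rewrite lee_fin.
apply: ae_ge0_le_integral => //.
- by move=> x _; apply: adde_ge0; rewrite lee_fin.
- exact: emeasurable_funD.
- by move=> x _; rewrite lee_fin.
- by apply: filterS hlp => x hx _; rewrite -EFinD lee_fin.
Qed.
End ProbabilityIntegrals.

(** * Rotation invariance of the uniform law *)

Section UniformSphere.
Context {R : realType} {d : nat} (mu : probability (borel_rV R d) R).
Hypothesis mu_unif : uniform_sphere mu.

Lemma coord_measurable_id : coord_measurable (id : borel_rV R d -> 'rV[R]_d).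
Proof. exact: coord_measurable_borel (@measurable_id _ _ setT). Qed.

Lemma measurable_sphere : measurable (@sphere R d : set (borel_rV R d)).
Proof.
rewrite (_ : @sphere R d =
  (fun x : borel_rV R d => enorm (x : 'rV[R]_d)) @^-1` [set 1]) //.
rewrite -[X in measurable X]setTI.
exact: measurable_enorm coord_measurable_id _ _ (measurable_set1 1).
Qed.

Lemma ae_sphere : {ae mu, forall x : borel_rV R d, sphere (x : 'rV[R]_d)}.
Proof.
exists (~` (@sphere R d : set (borel_rV R d))); split => //.
  by apply: measurableC; exact: measurable_sphere.
rewrite [LHS]probability_setC; last exact: measurable_sphere.
by rewrite [mu _]mu_unif.1 subee.
Qed.

(** Invariance, applied to preimages under [h], says that [h] and its rotated version have the same
    law on the real line; both integrals are computed from that law. *)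
Lemma integral_orthogonal (h : 'rV[R]_d -> R) (Q : 'M[R]_d) :
  (forall x, 0 <= h x) -> Q *m Q^T = 1%:M ->
  measurable_fun setT (h : borel_rV R d -> R) ->
  measurable_fun setT ((fun x => h (x *m Q)) : borel_rV R d -> R) ->
  (\int[mu]_x (h (x *m Q))%:E = \int[mu]_x (h x)%:E)%E.
Proof.
move=> h0 QQ mh mhQ.
(* The truncation is the identity on the values of [h] and makes the integrand nonnegative on the
   whole line. *)
have mE : measurable_fun [set: R] (fun y : R => (Num.max y 0)%:E).
  by apply/measurable_EFinP; apply: measurable_maxr.
have e0 (y : R) : (0 <= (Num.max y 0)%:E)%E by rewrite lee_fin le_max lexx orbT.
have E (h' : borel_rV R d -> R) : (forall x, 0 <= h' x) ->
    measurable_fun setT h' ->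
    (\int[mu]_x (h' x)%:E = \int[pushforward mu h']_y (Num.max y 0)%:E)%E.
  move=> h'0 mh'; rewrite ge0_integral_pushforward //.
  by apply: eq_integral => x _ /=; rewrite max_l.
rewrite !E //; apply: eq_measure_integral => A mA _.
rewrite /= /pushforward.
apply: (mu_unif.2 Q QQ (h @^-1` A)).
by rewrite -[X in measurable X]setTI; exact: mh.
Qed.

End UniformSphere.

(** * Mean logarithmic contraction of the Gram determinant *)

Section LogIntegrals.
Context {R : realType} {d : nat} {dX : measure_display} {X : measurableType dX}.
Context (mu : probability X R) (xi : X -> 'rV[R]_d).
Hypothesis mxi : coord_measurable xi.
Hypothesis xi_sphere : {ae mu, forall x, sphere (xi x)}.
Hypothesis xi_orthogonal : forall (h : 'rV[R]_d -> R) (Q : 'M[R]_d),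
  (forall x, 0 <= h x) -> Q *m Q^T = 1%:M ->
  measurable_fun setT (h \o xi) ->
  measurable_fun setT (fun x => h (xi x *m Q)) ->
  (\int[mu]_x (h (xi x *m Q))%:E = \int[mu]_x (h (xi x))%:E)%E.
Implicit Types f g u v : 'rV[R]_d.

Let measurable_dotpr f : measurable_fun setT (fun x => dotp f (xi x)).
Proof. exact: measurable_dotp (coord_measurable_cst f) mxi. Qed.

Context (k : R) (k0 : 0 < k).
Local Notation L h := (ln (1 + k * h)).

(** With [k = 2 eta + eta^2], this is the mean logarithm of the squared stretch of a unit vector
    under [I + eta x x^T]; [L2] is its analogue for the area spanned by an orthonormal pair. *)
Let L1 f := (\int[mu]_x (L (dotp f (xi x) ^+ 2))%:E)%E.
Let L2 f g := (\int[mu]_x (L (dotp f (xi x) ^+ 2 + dotp g (xi x) ^+ 2))%:E)%E.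

Let measurable_L (h : X -> R) : measurable_fun setT h ->
  measurable_fun setT (fun x => L (h x)).
Proof.
move=> mh; apply: (measurableT_comp (@measurable_ln R)).
by apply: measurable_funD => //; exact: measurable_funM.
Qed.

Let measurable_L1 f :
  measurable_fun setT (fun x : X => L (dotp f (xi x) ^+ 2)).
Proof. exact: measurable_L (measurable_funX _ (measurable_dotpr _)). Qed.

Let measurable_L2 f g : measurable_fun setT (fun x : X =>
  L (dotp f (xi x) ^+ 2 + dotp g (xi x) ^+ 2)).
Proof.
by apply: measurable_L; apply: measurable_funD; apply: measurable_funX;
  exact: measurable_dotpr.
Qed.

Let sqrD_ge0 (a b : R) : 0 <= a ^+ 2 + b ^+ 2.
Proof. by rewrite addr_ge0 ?sqr_ge0. Qed.

Lemma integral_ln1_unit f g : dotp f f = 1 -> dotp g g = 1 -> L1 f = L1 g.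
Proof.
move=> f1 g1; have [Q QQ fQ] := orthogonal_unit f1 g1.
rewrite /L1 -(@xi_orthogonal (fun x => L (dotp f x ^+ 2)) Q) //.
- by apply: eq_integral => x _; rewrite (fQ _).1.
- by move=> x; rewrite ln1M_ge0 ?sqr_ge0.
- exact: measurable_L1.
- by apply: eq_measurable_fun (measurable_L1 g) => x _; rewrite (fQ _).1.
Qed.

Lemma integral_ln2_orthonormal f1 f2 g1 g2 :
  dotp f1 f1 = 1 -> dotp f2 f2 = 1 -> dotp f1 f2 = 0 ->
  dotp g1 g1 = 1 -> dotp g2 g2 = 1 -> dotp g1 g2 = 0 ->
  L2 f1 f2 = L2 g1 g2.
Proof.
move=> f11 f22 f12 g11 g22 g12.
have [Q QQ fQ] := orthogonal_pair f11 f22 f12 g11 g22 g12.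
pose h := fun x => L (dotp f1 x ^+ 2 + dotp f2 x ^+ 2).
rewrite /L2 -(@xi_orthogonal h Q) //.
- by apply: eq_integral => x _; rewrite /h (fQ _).1 (fQ _).2.
- by move=> x; rewrite ln1M_ge0.
- exact: measurable_L2.
- apply: eq_measurable_fun (measurable_L2 g1 g2) => x _.
  by rewrite /h /= (fQ _).1 (fQ _).2.
Qed.

Let muT : mu [set: X] = 1%E.
Proof. exact: probability_setT. Qed.

Let ae_le_cst (h : X -> R) (c : R) : (forall x, 0 <= h x) ->
  measurable_fun setT h -> {ae mu, forall x : X, h x <= c} -> 0 <= c ->
  (\int[mu]_x (h x)%:E <= c%:E)%E.
Proof.
move=> h0 mh hc c0.
apply: (@le_trans _ _ (\int[mu]_x cst c%:E x)%E); last first.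
  by rewrite integral_cst //= muT mule1.
apply: ae_ge0_le_integral => //.
- by move=> x _; rewrite lee_fin.
- exact/measurable_EFinP.
- by apply: filterS hc => x hx _; rewrite lee_fin.
Qed.

Lemma integral_ln1_le f : dotp f f = 1 -> (L1 f <= (L 1)%:E)%E.
Proof.
move=> f1; apply: ae_le_cst => //.
- by move=> x; rewrite ln1M_ge0 ?sqr_ge0.
- have := xi_sphere; apply: filterS => x /sphereP x1.
  by rewrite ln1M_le ?sqr_ge0 // -f1 dotp_sqr_le.
- by rewrite ln1M_ge0.
Qed.

Lemma integral_ln2_le f g : dotp f f = 1 -> dotp g g = 1 ->
  (L2 f g <= (L 2)%:E)%E.
Proof.
move=> f1 g1; apply: ae_le_cst => //.
- by move=> x; rewrite ln1M_ge0.
- have := xi_sphere; apply: filterS => x /sphereP x1.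
  rewrite ln1M_le //.
  by have := dotp_sqr_le f x1; have := dotp_sqr_le g x1; lra.
- by rewrite ln1M_ge0.
Qed.

Let L1_fin f : dotp f f = 1 -> L1 f \is a fin_num.
Proof.
move=> f1; rewrite ge0_fin_numE.
  by apply: (le_lt_trans (integral_ln1_le f1)); rewrite ltry.
by apply: integral_ge0 => x _; rewrite lee_fin ln1M_ge0 ?sqr_ge0.
Qed.

Let L2_fin f g : dotp f f = 1 -> dotp g g = 1 -> L2 f g \is a fin_num.
Proof.
move=> f1 g1; rewrite ge0_fin_numE.
  by apply: (le_lt_trans (integral_ln2_le f1 g1)); rewrite ltry.
by apply: integral_ge0 => x _; rewrite lee_fin ln1M_ge0.
Qed.

Let defect f g (x : X) := L (dotp f (xi x) ^+ 2) +
  L (dotp g (xi x) ^+ 2) -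
  L (dotp f (xi x) ^+ 2 + dotp g (xi x) ^+ 2).

Let defect_ge0 f g x : 0 <= defect f g x.
Proof. by rewrite subr_ge0 ln1MD_le ?sqr_ge0. Qed.

Let measurable_defect f g : measurable_fun setT (defect f g).
Proof. by apply: measurable_funB => //; exact: measurable_funD. Qed.

(** Stated as a sum, so that it holds before the integrals are known to be finite. *)
Let integral_defect f g :
  (\int[mu]_x (defect f g x)%:E + L2 f g = L1 f + L1 g)%E.
Proof.
rewrite /L1 /L2 -!ge0_integralD //.
- by apply: eq_integral => x _; rewrite -!EFinD subrK.
all: try (by move=> x _; rewrite lee_fin ?ln1M_ge0 ?sqr_ge0).
all: exact/measurable_EFinP.
Qed.

(** Equality forces the nonnegative [defect] to have integral zero, hence to vanish almost
    everywhere, and [ln1MD_eq] applies pointwise. *)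
Lemma ae_dotpM_eq0 f g : dotp f f = 1 -> dotp g g = 1 ->
  L2 f g = (L1 f + L1 g)%E ->
  {ae mu, forall x : X, dotp f (xi x) * dotp g (xi x) = 0}.
Proof.
move=> f1 g1 E; have I0 : (\int[mu]_x `|(defect f g x)%:E| = 0)%E.
  under eq_integral do rewrite gee0_abs ?lee_fin //.
  have := congr1 (fun y => y - L2 f g)%E (integral_defect f g).
  by rewrite -E addeK ?subee // L2_fin.
have mD : measurable_fun setT (EFin \o defect f g) by exact/measurable_EFinP.
have /(ae_eq_integral_abs mu measurableT mD).1 := I0.
apply: filterS => x /(_ I) /= [] /eqP; rewrite subr_eq0 => /eqP Ex.
have /eqP := ln1MD_eq k0 (sqr_ge0 _) (sqr_ge0 _) (esym Ex).
by rewrite -exprMn sqrf_eq0 => /eqP.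
Qed.

Hypothesis d2 : (2 <= d)%N.

(* In the equality case, x_k x_l = 0 and, for the pair (e_k +- e_l) / sqrt 2,
   x_k^2 = x_l^2 would hold almost surely. *)
Lemma integral_ln2_lt f g : dotp f f = 1 -> dotp g g = 1 -> dotp f g = 0 ->
  (L2 f g < L1 f + L1 g)%E.
Proof.
move=> f1 g1 fg; rewrite ltNge; apply/negP => le21.
(* By rotation invariance, equality for one orthonormal pair gives equality for all of them. *)
have E f' g' : dotp f' f' = 1 -> dotp g' g' = 1 -> dotp f' g' = 0 ->
    L2 f' g' = (L1 f' + L1 g')%E.
  move=> f'1 g'1 f'g'; apply/eqP; rewrite eq_le; apply/andP; split.
    rewrite -integral_defect leeDr // integral_ge0 // => x _.
    by rewrite lee_fin.
  rewrite (integral_ln1_unit f'1 f1) (integral_ln1_unit g'1 g1).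
  by rewrite (integral_ln2_orthonormal f'1 g'1 f'g' f1 g1 fg).
have x0 (i : 'I_d) : {ae mu, forall x : X, xi x ord0 i = 0}.
  have [j ji] : exists j : 'I_d, j != i.
    have [j0 j1] : (0 < d /\ 1 < d)%N by split => //; exact: ltnW.
    have [i0|i0] := eqVneq i (Ordinal j0); last first.
      by exists (Ordinal j0); rewrite eq_sym.
    by exists (Ordinal j1); rewrite i0.
  pose ei : 'rV[R]_d := delta_mx ord0 i; pose ej : 'rV[R]_d := delta_mx ord0 j.
  have eii : dotp ei ei = 1 by rewrite dotp_delta mxE !eqxx.
  have ejj : dotp ej ej = 1 by rewrite dotp_delta mxE !eqxx.
  have eij : dotp ei ej = 0 by rewrite dotp_delta mxE (negbTE ji) andbF.
  pose r : R := Num.sqrt 2^-1.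
  have r2 : r ^+ 2 = 2^-1 by rewrite sqr_sqrtr.
  pose p := r *: (ei + ej); pose q := r *: (ei - ej).
  have pp : dotp p p = 1.
    by rewrite /p /q !dotpE eii ejj (dotpC ej) eij; lra.
  have qq : dotp q q = 1.
    by rewrite /p /q !dotpE eii ejj (dotpC ej) eij; lra.
  have pq : dotp p q = 0 by rewrite /p /q !dotpE eii ejj (dotpC ej) eij; lra.
  have h1 := ae_dotpM_eq0 eii ejj (E _ _ eii ejj eij).
  have h2 := ae_dotpM_eq0 pp qq (E _ _ pp qq pq).
  apply: filterS2 h1 h2 => x /=.
  rewrite /p /q !dotpE !(dotpC _ (xi x)) !dotp_delta.
  move: ((xi x) ord0 i) ((xi x) ord0 j) => a b ab.
  move=> h.
  have h' : a ^+ 2 = b ^+ 2.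
    have : r ^+ 2 * (a ^+ 2 - b ^+ 2) = 0 by rewrite -h; ring.
    by rewrite r2; lra.
  (* Indeed [a^4 = a^2 b^2 = (a b)^2 = 0]. *)
  apply/eqP; rewrite -[_ == _](expf_eq0 a 4) /=.
  by rewrite (exprM a 2 2) expr2 {2}h' -exprMn ab expr0n.
(* Total mass 1 yields a point where all the almost sure statements hold at once: a unit vector with
   zero coordinates. *)
have mu_gt0 : (0 < mu [set: X])%E by rewrite muT lte01.
have PF := ae_properfilter_algebraOfSetsType mu_gt0.
have [x [/sphereP x1 xi0]] : exists x : X,
    sphere (xi x) /\ forall i, (xi x) ord0 i = 0.
  have := filter_ex (filterI xi_sphere (filter_forall _ x0)); case => x hx.
  by exists x.
move: x1; rewrite /dotp big1 => [|i _]; last by rewrite xi0 mul0r.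
by move/esym/eqP; rewrite oner_eq0.
Qed.

Lemma integral_gram_update_le (eta beta : R) u v f g :
  0 < eta -> k = 2 * eta + eta ^+ 2 ->
  0 < beta -> beta * (2 * L 2) <= 2^-1 ->
  dotp f f = 1 -> dotp g g = 1 -> dotp f g = 0 ->
  sphere u -> sphere v ->
  (\int[mu]_x (gram (update eta u (xi x)) (update eta v (xi x)) `^ beta)%:E <=
   (gram u v `^ beta * (1 + 2 * (beta * (2 * L 2)) ^+ 2 +
     beta * (fine (L2 f g) - 2 * fine (L1 f))))%:E)%E.
Proof.
move=> eta0 kE beta0 betaL f1 g1 fg su sv.
have mupd w : coord_measurable (fun x => update eta w (xi x)).
  exact: coord_measurable_update (coord_measurable_cst w) mxi.
have [G0|Gneq] := eqVneq (gram u v) 0.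
  under eq_integral do rewrite (gram_update0 eta0 _ su sv G0) powR0 ?gt_eqF //.
  by rewrite integral0 G0 powR0 ?gt_eqF // mul0r.
have Ggt : 0 < gram u v by rewrite lt_neqAle eq_sym Gneq gram_ge0.
have [h [h1 uh hE]] := gram_update eta0 su sv Ggt.
have u1 := (sphereP u).1 su; have v1 := (sphereP v).1 sv.
set B := gram u v `^ beta; have B0 : 0 < B by rewrite powR_gt0.
set K := 1 + 2 * (beta * (2 * L 2)) ^+ 2.
have K0 : 0 <= K by rewrite addr_ge0 // mulr_ge0 // sqr_ge0.
have L1E w : dotp w w = 1 -> L1 w = (fine (L1 f))%:E.
  by move=> w1; rewrite (integral_ln1_unit w1 f1) fineK // L1_fin.
have L2E : L2 u h = (fine (L2 f g))%:E.
  rewrite (integral_ln2_orthonormal u1 h1 uh f1 g1 fg) fineK // L2_fin //.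
pose F x := gram (update eta u (xi x)) (update eta v (xi x)) `^ beta.
have mF : measurable_fun setT F.
  apply: (measurableT_comp (measurable_powR beta)).
  exact: measurable_gram (mupd u) (mupd v).
pose l w x := L (dotp w (xi x) ^+ 2).
pose lp x := L (dotp u (xi x) ^+ 2 + dotp h (xi x) ^+ 2).
have l0 w x : 0 <= l w x by rewrite ln1M_ge0 ?sqr_ge0.
have lp0 x : 0 <= lp x by rewrite ln1M_ge0.
have ml w : measurable_fun setT (l w) by exact: measurable_L1.
have mlp : measurable_fun setT lp by exact: measurable_L2.
have b0 : 0 <= B * beta by rewrite mulr_ge0 ?ltW.
(* The leading [0 +] gives the left side the affine shape of [ge0_integral_affine]. *)
have pointwise : {ae mu, forall x : X,
    F x + (0 + B * beta * (l u x + l v x)) <= B * K + B * beta * lp x}.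
  move: xi_sphere; apply: filterS => x sx.
  have x1 := (sphereP _).1 sx.
  rewrite /F hE // -kE powRM ?gram_ge0 //; last first.
    by rewrite divr_ge0 ?mulr_ge0 // ltW // add1M_gt0 ?sqr_ge0.
  rewrite -/B.
  have a01 : 0 <= dotp u (xi x) ^+ 2 <= 1 by rewrite sqr_ge0 -u1 dotp_sqr_le.
  have b01 : 0 <= dotp v (xi x) ^+ 2 <= 1 by rewrite sqr_ge0 -v1 dotp_sqr_le.
  have p02 : 0 <= dotp u (xi x) ^+ 2 + dotp h (xi x) ^+ 2 <= 2.
    rewrite sqrD_ge0 /=.
    by have := dotp_sqr_le u x1; have := dotp_sqr_le h x1; lra.
  have := powR_ratio_le k0 a01 b01 p02 (ltW beta0) betaL.
  rewrite -[L (dotp u (xi x) ^+ 2)]/(l u x) -[L (dotp v (xi x) ^+ 2)]/(l v x).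
  rewrite -[L (_ + _)]/(lp x) -/K -(ler_pM2l B0).
  move: (_ `^ beta) (l u x) (l v x) (lp x) => r y z w.
  lra.
have F0 x : 0 <= F x by exact: powR_ge0.
have mZ a c (w : X -> R) : measurable_fun setT w ->
    measurable_fun setT (fun x => a + c * w x).
  by move=> mw; apply: measurable_funD => //; exact: measurable_funM.
have Z0 a c (w : X -> R) : 0 <= a -> 0 <= c -> (forall x, 0 <= w x) ->
    forall x, 0 <= a + c * w x.
  by move=> a0 c0 w0 x; rewrite addr_ge0 // mulr_ge0.
have ll0 x : 0 <= l u x + l v x by rewrite addr_ge0.
have mll : measurable_fun setT (fun x => l u x + l v x).
  exact: measurable_funD.
have Ill := ge0_integralD_fin (l0 u) (l0 v) (ml u) (ml v) (L1E _ u1) (L1E _ v1).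
have BK0 : 0 <= B * K by rewrite mulr_ge0 // ltW.
have Il := ge0_integral_affine b0 (lexx 0) ll0 mll Ill.
have Ip := ge0_integral_affine b0 BK0 lp0 mlp L2E.
have := ae_integral_leB F0 (Z0 _ _ _ (lexx 0) b0 ll0) (Z0 _ _ _ BK0 b0 lp0) mF
  (mZ _ _ _ mll) (mZ _ _ _ mlp) pointwise Il Ip.
move=> /le_trans; apply; rewrite lee_fin; lra.
Qed.

Lemma integral_gram_contraction (eta : R) : 0 < eta -> k = 2 * eta + eta ^+ 2 ->
  exists beta rho : R, [/\ 0 < beta, 0 <= rho < 1 &
   forall u v, sphere u -> sphere v ->
  (\int[mu]_x (gram (update eta u (xi x)) (update eta v (xi x)) `^ beta)%:E <=
   (rho * gram u v `^ beta)%:E)%E].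
Proof.
move=> eta0 kE; have [j0 j1] : (0 < d /\ 1 < d)%N by split => //; exact: ltnW.
pose f : 'rV[R]_d := delta_mx ord0 (Ordinal j0).
pose g : 'rV[R]_d := delta_mx ord0 (Ordinal j1).
have f1 : dotp f f = 1 by rewrite dotp_delta mxE !eqxx.
have g1 : dotp g g = 1 by rewrite dotp_delta mxE !eqxx.
have fg : dotp f g = 0 by rewrite dotp_delta mxE andbF.
set M1 := fine (L1 f); set M2 := fine (L2 f g).
have E1 : L1 f = M1%:E by rewrite fineK // L1_fin.
have E2 : L2 f g = M2%:E by rewrite fineK // L2_fin.
have := integral_ln2_lt f1 g1 fg; rewrite -[L1 g](integral_ln1_unit f1 g1).
rewrite E1 E2 -EFinD lte_fin => M21.
have M20 : 0 <= M2.
  by rewrite -lee_fin -E2 integral_ge0 // => x _; rewrite lee_fin ln1M_ge0.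
have M1C : M1 <= L 2.
  rewrite -lee_fin -E1 (le_trans (integral_ln1_le f1)) // lee_fin ln1M_le //.
  by rewrite ler1n.
set C := 2 * L 2; set delta := 2 * M1 - M2.
have d0 : 0 < delta by rewrite /delta; lra.
have dC : delta <= C by rewrite /delta /C; lra.
have C0 : 0 < C by exact: lt_le_trans dC.
(* This minimizes [1 + 2 (beta C)^2 - beta delta], with minimum [1 - r^2 / 8] for [r = delta / C].
   From [r <= 1] follow both the smallness of [beta C] and the nonnegativity of the minimum. *)
pose beta := delta / (4 * C ^+ 2).
have beta0 : 0 < beta by rewrite divr_gt0 // mulr_gt0 // exprn_gt0.
have bC : beta * C = delta / C / 4 by rewrite /beta; field; rewrite gt_eqF.
have r1 : delta / C <= 1 by rewrite ler_pdivrMr // mul1r.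
have r0 : 0 < delta / C by rewrite divr_gt0.
set r := delta / C in bC r0 r1.
have bd : beta * delta = r ^+ 2 / 4 by rewrite /beta /r; field; rewrite gt_eqF.
exists beta, (1 - r ^+ 2 / 8); split => //; first by nra.
move=> u v su sv.
apply: (le_trans (integral_gram_update_le eta0 kE beta0 _ f1 g1 fg su sv)).
  by rewrite bC; lra.
rewrite lee_fin mulrC ler_wpM2r ?powR_ge0 // -/C bC -/M1 -/M2.
rewrite (_ : M2 - 2 * M1 = - delta) ?mulrN ?bd; last by rewrite /delta; ring.
lra.
Qed.

End LogIntegrals.

(** * Almost sure convergence from geometrically decaying means *)

Section SummableIntegrals.
Context {R : realType} {dT : measure_display} {T : measurableType dT}.
Context (P : {measure set T -> \bar R}) (h : nat -> T -> R).
Hypothesis h0 : forall t w, 0 <= h t w.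
Hypothesis mh : forall t, measurable_fun setT (h t).

Lemma sum_geometric_le (r : R) n : 0 <= r < 1 ->
  \sum_(0 <= i < n) r ^+ i <= (1 - r)^-1.
Proof.
move=> /andP[r0 r1]; have r1' : 0 < 1 - r by rewrite subr_gt0.
rewrite -[leRHS]mul1r ler_pdivlMr //.
have -> : (\sum_(0 <= i < n) r ^+ i) * (1 - r) = 1 - r ^+ n.
  elim: n => [|n IH]; first by rewrite big_geq // mul0r expr0 subrr.
  by rewrite big_nat_recr //= mulrDl IH exprS; ring.
by rewrite gerBl exprn_ge0.
Qed.

(** The sum over [t] has integral at most [1 / (1 - r)], so it is finite almost everywhere. *)
Lemma ae_cvg0_geometric_integral (r : R) : 0 <= r < 1 ->
  (forall t, \int[P]_w (h t w)%:E <= (r ^+ t)%:E)%E ->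
  {ae P, forall w, (fun t => h t w) @ \oo --> (0 : R)}.
Proof.
move=> r01 hr.
have mhE t : measurable_fun setT (EFin \o h t) by exact/measurable_EFinP.
have hE0 t w : (0 <= (h t w)%:E)%E by rewrite lee_fin.
pose S w := (\sum_(0 <= t <oo) (h t w)%:E)%E.
have S0 w : (0 <= S w)%E by exact: nneseries_ge0.
have mS : measurable_fun setT S.
  by apply: ge0_emeasurable_sum => t *; [exact: hE0|exact: mhE].
have intS : P.-integrable setT S.
  apply/integrableP; split => //.
  under eq_integral do rewrite gee0_abs ?S0 //.
  rewrite integral_nneseries //.
  apply: (@le_lt_trans _ _ ((1 - r)^-1)%:E); last exact: ltry.
  apply: lime_le.
    by apply: is_cvg_nneseries => t _ _; exact: integral_ge0.
  apply: nearW => n.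
  apply: le_trans (_ : _ <= (\sum_(0 <= i < n) (r ^+ i)%:E))%E _.
    by apply: lee_sum => t _; exact: hr.
  by rewrite sumEFin lee_fin sum_geometric_le.
have := integrable_ae measurableT intS; apply: filterS => w /(_ I) Sw.
have Soo : (S w < +oo)%E by rewrite ltey_eq Sw.
have tail := @nneseries_tail_cvg R (fun t => (h t w)%:E) xpredT Soo
  (fun k _ => hE0 k w).
(* Each term is bounded by the tail of the series that starts with it. *)
have : (fun t => (h t w)%:E) @ \oo --> 0%:E.
  apply: (squeeze_cvge _ (cvg_cst _) tail); apply: nearW => t.
  rewrite hE0 /=.
  have := @nneseries_lim_ge R (fun t => (h t w)%:E) xpredT t t.+1.
  by rewrite big_nat1; apply.
by move=> /fine_cvgP[].
Qed.
End SummableIntegrals.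

(** * Independence of the present intervention from the past *)

Section Past.
Context {R : realType} {dT dE : measure_display}.
Context {T : measurableType dT} {E : measurableType dE} (P : probability T R).
Context (v : nat -> {RV P >-> E}).
Hypothesis v_indep : mutually_independent v.

(** A pi-system generating the sigma-algebra of the interventions strictly before time [t]; mutual
    independence speaks directly about such events. *)
Definition past_cylinders (t : nat) : set (set T) :=
  [set B | exists2 A : nat -> set E, forall s, measurable (A s) &
    B = \bigcap_(s in `I_t) (v s @^-1` A s)].

(** A copy of [T] with the coarser sigma-algebra, so that Tonelli can be used on [past t * E]. *)
Definition past (t : nat) := g_sigma_algebraType (past_cylinders t).

Lemma past_cylindersT t : past_cylinders t setT.
Proof.
exists (fun=> setT) => //.
by apply/esym; rewrite -subTset => w _ s _.
Qed.

Lemma setI_closed_past_cylinders t : setI_closed (past_cylinders t).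
Proof.
move=> _ _ [A mA ->] [B mB ->]; exists (fun s => A s `&` B s).
  by move=> s; exact: measurableI.
apply/seteqP; split => w.
  by move=> [hA hB] s st; split; [exact: hA|exact: hB].
by move=> h; split => s st; have [] := h s st.
Qed.

Lemma measurable_past_cylinders t : past_cylinders t `<=` measurable.
Proof.
move=> _ [A mA ->]; apply: bigcap_measurableType => s _.
by rewrite -[X in measurable X]setTI; exact: measurable_funP.
Qed.

Lemma measurable_past t (B : set T) :
  measurable (B : set (past t)) -> measurable B.
Proof.
apply: smallest_sub; first exact: sigma_algebra_measurable.
exact: measurable_past_cylinders.
Qed.

Lemma measurable_preimage_rv s (A : set E) : measurable A ->
  measurable (v s @^-1` A).
Proof.
by move=> mA; rewrite -[X in measurable X]setTI; exact: measurable_funP.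
Qed.

Lemma past_cylinders_indep t (B : set T) (C : set E) : past_cylinders t B ->
  measurable C -> P (B `&` v t @^-1` C) = (P B * P (v t @^-1` C))%E.
Proof.
move=> [A mA ->] mC.
pose J : {fset nat} := [fset s in iota 0 t]%fset.
have JE : [set` J] = `I_t.
  by apply/seteqP; split => s /=; rewrite !inE /= mem_iota add0n.
(* Overriding the family at time [t] turns the intersection into one cylinder over [J] and [t], to
   which mutual independence applies. *)
pose A' s := if s == t then C else A s.
have mA' s : measurable (A' s) by rewrite /A'; case: ifP.
have tJ : t \notin J by rewrite !inE /= mem_iota add0n ltnn andbF.
have AA' s : s \in J -> v s @^-1` A' s = v s @^-1` A s.
  by move=> sJ; rewrite /A'; case: eqP => // st; rewrite -st sJ in tJ.
have -> : \bigcap_(s in `I_t) (v s @^-1` A s) `&` v t @^-1` C =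
    \bigcap_(s in [set` (t |` J)%fset]) (v s @^-1` A' s).
  rewrite set_fsetU1 JE bigcap_setU1 setIC; congr (_ `&` _).
    by rewrite /A' eqxx.
  apply: eq_bigcapr => s /= st; rewrite AA' //.
  by have : [set` J] s by rewrite JE.
rewrite v_indep // big_fsetU1 //= /A' eqxx muleC; congr (_ * _)%E.
rewrite -JE v_indep //; apply: eq_fbigr => s sJ _.
by rewrite -/(A' s) AA'.
Qed.

(** Both sides are finite measures in [B] that agree on the pi-system of cylinders, hence on the
    sigma-algebra it generates. *)
Lemma past_indep t (B : set T) (C : set E) : measurable (B : set (past t)) ->
  measurable C -> P (B `&` v t @^-1` C) = (P B * P (v t @^-1` C))%E.
Proof.
move=> mB mC; have mD := measurable_preimage_rv t mC.
pose r : {nonneg R} := NngNum (fine_ge0 (measure_ge0 P (v t @^-1` C))).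
have PC : P (v t @^-1` C) = r%:num%:E by rewrite /= fineK // fin_num_measure.
have -> : P (B `&` v t @^-1` C) = mrestr P mD B by [].
have -> : (P B * P (v t @^-1` C) = mscale r P B)%E by rewrite muleC PC.
apply: (@g_sigma_algebra_measure_unique _ R T (past_cylinders t)
  (@measurable_past_cylinders t) (fun=> setT)) mB.
- by move=> _; exact: past_cylindersT.
- by rewrite bigcup_const //; exists 0%N.
- exact: setI_closed_past_cylinders.
- move=> A cA; have := past_cylinders_indep cA mC.
  by rewrite PC muleC.
- move=> _; have mI := measurableI _ _ measurableT mD.
  exact: le_lt_trans (probability_le1 P mI) (ltry 1).
Qed.

Lemma measurable_rv_past s t : (s < t)%N ->
  measurable_fun setT (v s : past t -> E).
Proof.
move=> st _ A mA; rewrite setTI; apply: sub_sigma_algebra.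
exists (fun r => if r == s then A else setT) => [r|]; first by case: ifP.
apply/seteqP; split => w /= h; first by move=> r _ /=; case: eqP => // ->.
by have := h s st; rewrite /= eqxx.
Qed.

(** The distribution of this map is the restriction of [P] to the past. *)
Let idP t : T -> past t := id.

Let measurable_idP t : measurable_fun setT (idP t).
Proof. by move=> _ B mB; rewrite setTI; exact: measurable_past mB. Qed.

HB.instance Definition _ t :=
  isMeasurableFun.Build _ _ _ _ (idP t) (@measurable_idP t).

Let joint t : T -> past t * E := fun w => (idP t w, v t w).

Let measurable_joint t : measurable_fun setT (joint t).
Proof. exact: measurable_fun_pair. Qed.

HB.instance Definition _ t :=
  isMeasurableFun.Build _ _ _ _ (joint t) (@measurable_joint t).

(* The value at time t is integrated out first, being independent of the past. *)
Lemma integral_past t (g : past t * E -> \bar R) (b : T -> R) :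
  measurable_fun setT g -> (forall z, 0 <= g z)%E ->
  measurable_fun setT (b : past t -> R) -> (forall w, 0 <= b w) ->
  (forall w : past t, \int[distribution P (v t)]_y g (w, y) <= (b w)%:E)%E ->
  (\int[P]_w g ((w : past t), v t w) <= \int[P]_w (b w)%:E)%E.
Proof.
move=> mg g0 mb b0 gb.
have mbE : measurable_fun setT (EFin \o (b : past t -> R)).
  exact/measurable_EFinP.
have -> : (\int[P]_w (b w)%:E = \int[distribution P (idP t)]_w (b w)%:E)%E.
  by rewrite ge0_integral_distribution // => w; rewrite lee_fin.
have -> : (\int[P]_w g ((w : past t), v t w) =
    \int[distribution P (joint t)]_z g z)%E.
  by rewrite ge0_integral_distribution.
(* By independence the joint law agrees with the product law on rectangles, which determine it. *)
have -> : (\int[distribution P (joint t)]_z g z =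
    \int[distribution P (idP t) \x distribution P (v t)]_z g z)%E.
  apply: eq_measure_integral => A mA _; apply/esym.
  apply: (product_measure_unique _ mA) => B C mB mC.
  exact: past_indep.
rewrite fubini_tonelli1 //; apply: ge0_le_integral => //.
- by move=> w _; exact: integral_ge0.
- exact: measurable_fun_fubini_tonelli_F.
- by move=> w _; exact: gb.
Qed.
End Past.

(** * The random evolution of a pair of opinions *)

Lemma coord_measurable_opinion (R : realType) d (eta : R) (u : 'rV[R]_d)
    dT (T : measurableType dT) (f : nat -> T -> 'rV[R]_d) t :
  (forall s, (s < t)%N -> coord_measurable (f s)) ->
  coord_measurable (fun w => opinion eta u (fun s => f s w) t).
Proof.
elim: t => [|t IH] mf /=; first exact: coord_measurable_cst.
apply: coord_measurable_update; last exact: mf.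
by apply: IH => s st; apply: mf; exact: ltnW.
Qed.

Section UniformInterventions.
Context {R : realType} {d : nat} {eta : R}.
Context {disp : measure_display} {T : measurableType disp} {P : probability T R}.
Context {v : nat -> {RV P >-> borel_rV R d}}.
Hypotheses (d2 : (2 <= d)%N) (eta0 : 0 < eta) (v_iid : iid v).
Hypothesis v_unif : forall t, uniform_sphere (distribution P (v t)).

(** The constants come from the law at time 0; identical distribution carries them to every [t]. *)
Lemma uniform_gram_contraction : exists beta rho : R,
  [/\ 0 < beta, 0 <= rho < 1 & forall t x y, sphere x -> sphere y ->
  (\int[distribution P (v t)]_z
     (gram (update eta x (z : 'rV[R]_d)) (update eta y (z : 'rV[R]_d)) `^ beta)%:E
   <= (rho * gram x y `^ beta)%:E)%E].
Proof.
have [beta [rho [beta0 rho1 h]]] := @integral_gram_contraction R d _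
  (borel_rV R d) (distribution P (v 0%N)) id coord_measurable_id
  (ae_sphere (v_unif 0%N))
  (fun h Q h0 QQ => integral_orthogonal (v_unif 0%N) h0 QQ)
  _ (kap_gt0 eta0) d2 eta eta0 erefl.
exists beta, rho; split => // t x y sx sy; apply: le_trans (h x y sx sy).
rewrite le_eqVlt; apply/orP; left; apply/eqP.
by apply: eq_measure_integral => A mA _; exact: v_iid.2.
Qed.

Section Pair.
Context (x y : 'rV[R]_d) (sx : sphere x) (sy : sphere y).

Let U t w := opinion eta x (fun s => v s w : 'rV[R]_d) t.
Let V t w := opinion eta y (fun s => v s w : 'rV[R]_d) t.

Let measurable_U t : coord_measurable (U t).
Proof.
apply: coord_measurable_opinion => s _; apply: coord_measurable_borel.
exact: measurable_funP.
Qed.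

Let measurable_V t : coord_measurable (V t).
Proof.
apply: coord_measurable_opinion => s _; apply: coord_measurable_borel.
exact: measurable_funP.
Qed.

Let sU t w : sphere (U t w). Proof. exact: opinion_sphere. Qed.
Let sV t w : sphere (V t w). Proof. exact: opinion_sphere. Qed.

(** Given the past, the pair at time [t] is fixed and the contraction is applied to the fresh
    intervention. *)
Lemma integral_gram_step (beta rho : R) t : 0 < beta -> 0 <= rho ->
  (forall x y, sphere x -> sphere y ->
  (\int[distribution P (v t)]_z
     (gram (update eta x (z : 'rV[R]_d)) (update eta y (z : 'rV[R]_d)) `^ beta)%:E
   <= (rho * gram x y `^ beta)%:E)%E) ->
  (\int[P]_w (gram (U t.+1 w) (V t.+1 w) `^ beta)%:E <=
   rho%:E * \int[P]_w (gram (U t w) (V t w) `^ beta)%:E)%E.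
Proof.
move=> beta0 rho0 contr.
(* The state at time [t] involves only interventions before [t], hence is measurable for the
   past. *)
have mpast z : coord_measurable (fun w : past v t =>
    opinion eta z (fun s => v s w : 'rV[R]_d) t).
  apply: coord_measurable_opinion => s st; apply: coord_measurable_borel.
  exact: measurable_rv_past.
have mpow dX (X : measurableType dX) (f g : X -> 'rV[R]_d) :
    coord_measurable f -> coord_measurable g ->
    measurable_fun setT (fun z => gram (f z) (g z) `^ beta).
  move=> mf mg; apply: (measurableT_comp (measurable_powR beta)).
  exact: measurable_gram.
have mstep z : coord_measurable (fun wz : past v t * borel_rV R d =>
    update eta (opinion eta z (fun s => v s wz.1 : 'rV[R]_d) t)
      (wz.2 : 'rV[R]_d)).
  apply: coord_measurable_update => [k|].
    exact: measurableT_comp (mpast z k) measurable_fst.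
  apply: coord_measurable_borel; exact: measurable_snd.
have mUV : measurable_fun setT (fun w => (gram (U t w) (V t w) `^ beta)%:E).
  by apply/measurable_EFinP; exact: mpow.
rewrite -ge0_integralZl //; last by move=> w _; rewrite lee_fin powR_ge0.
under [leRHS]eq_integral do rewrite -EFinM.
apply: (integral_past (v_iid.1) (t := t)
  (g := fun wz => (gram
    (update eta (opinion eta x (fun s => v s wz.1 : 'rV[R]_d) t)
      (wz.2 : 'rV[R]_d))
    (update eta (opinion eta y (fun s => v s wz.1 : 'rV[R]_d) t)
      (wz.2 : 'rV[R]_d)) `^ beta)%:E)
  (b := fun w => rho * gram (U t w) (V t w) `^ beta)).
- by apply/measurable_EFinP; exact: mpow.
- by move=> z; rewrite lee_fin powR_ge0.
- by apply: measurable_funM => //; exact: (mpow _ _ _ _ (mpast x) (mpast y)).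
- by move=> w; rewrite mulr_ge0 // powR_ge0.
- by move=> w; exact: contr (sU t w) (sV t w).
Qed.

Lemma ae_gram_cvg0 :
  {ae P, forall w, (fun t => gram (U t w) (V t w)) @ \oo --> (0 : R)}.
Proof.
have [beta [rho [beta0 rho1 contr]]] := uniform_gram_contraction.
have /andP[rho0 _] := rho1.
have mG t : measurable_fun setT (fun w => gram (U t w) (V t w) `^ beta).
  apply: (measurableT_comp (measurable_powR beta)).
  exact: measurable_gram.
have le_rho t : (\int[P]_w (gram (U t w) (V t w) `^ beta)%:E <= (rho ^+ t)%:E)%E.
  elim: t => [|t IH].
    rewrite expr0; apply: (@le_trans _ _ (\int[P]_w cst 1%:E w)%E); last first.
      by rewrite integral_cst //= probability_setT mule1.
    apply: ge0_le_integral => //.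
    - by move=> w _; rewrite lee_fin powR_ge0.
    - by apply/measurable_EFinP; exact: mG.
    - move=> w _; have e1 : 1 `^ beta = 1 :> R by rewrite powR1.
      rewrite lee_fin -[leRHS]e1.
      by rewrite ge0_ler_powR ?nnegrE ?gram_ge0 ?gram_le1 ?ltW.
  apply: (le_trans (integral_gram_step beta0 rho0 (contr t))).
  by rewrite exprS EFinM; apply: lee_wpmul2l; rewrite ?lee_fin.
have := ae_cvg0_geometric_integral (fun t w => powR_ge0 _ _) mG rho1 le_rho.
apply: filterS => w /cvgrPdist_lt h; apply/cvgrPdist_lt => e e0.
have := h (e `^ beta) (powR_gt0 _ e0); apply: filterS => t.
rewrite !sub0r !normrN ger0_norm ?powR_ge0 // ger0_norm ?gram_ge0 //.
apply: contraTT; rewrite -!leNgt => eg.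
by rewrite ge0_ler_powR ?nnegrE ?gram_ge0 ?(ltW e0) ?(ltW beta0).
Qed.

(** A countable union of null sets is null; the deterministic argument needs unit interventions at
    all times at once. *)
Lemma ae_interventions_sphere : {ae P, forall w t, sphere (v t w : 'rV[R]_d)}.
Proof.
apply: ae_foralln => t.
have mS := @measurable_sphere R d.
exists (~` (v t @^-1` (@sphere R d : set (borel_rV R d)))); split => //.
  by apply: measurableC; exact: measurable_preimage_rv.
rewrite [LHS]probability_setC; last exact: measurable_preimage_rv.
by rewrite [X in (_ - X)%E](v_unif t).1 subee.
Qed.

Lemma measurable_sync : measurable
  [set w | ((fun t => enorm (U t w - V t w)) @ \oo --> (0 : R)) \/
           ((fun t => enorm (U t w + V t w)) @ \oo --> (0 : R))].
Proof.
apply: measurableU; apply: measurable_cvg0 => t; apply: measurable_enorm.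
  apply: coord_measurableD => // k.
  apply: (eq_measurable_fun (fun w => - V t w ord0 k)).
    by move=> w _; rewrite mxE.
  by apply: measurable_funN; exact: measurable_V.
exact: coord_measurableD.
Qed.

Lemma probability_sync : P
  [set w | ((fun t => enorm (U t w - V t w)) @ \oo --> (0 : R)) \/
           ((fun t => enorm (U t w + V t w)) @ \oo --> (0 : R))] = 1%E.
Proof.
set S := [set w | _]; have mS : measurable S by exact: measurable_sync.
suff /negligibleP : P.-negligible (~` S).
  move=> /(_ (measurableC mS)) S0; rewrite -[S]setCK probability_setC.
    by rewrite S0 sube0.
  exact: measurableC.
have : {ae P, forall w, S w}.
  apply: filterS2 ae_gram_cvg0 ae_interventions_sphere => w G0 vS.
  exact: gram_cvg0_sync eta0 sx sy vS G0.
by apply.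
Qed.
End Pair.
End UniformInterventions.

Theorem theorem3p1 (R : realType) (d n : nat) (eta : R)
    (hd : (2 <= d)%N) (hn : (1 <= n)%N) (heta : 0 < eta)
    (u1 : 'I_n -> 'rV[R]_d) (hu1 : forall i, sphere (u1 i))
    (disp : measure_display) (T : measurableType disp) (P : probability T R)
    (v : nat -> {RV P >-> borel_rV R d})
    (hiid : iid v)
    (hunif : forall t, uniform_sphere (distribution P (v t)))
    (i j : 'I_n) (hij : (i < j)%N) :
  let u (k : 'I_n) (t : nat) (w : T) : 'rV[R]_d :=
    opinion eta (u1 k) (fun s => v s w) t in
  let E : set T :=
    [set w | ((fun t => enorm (u i t w - u j t w)) @ \oo --> (0 : R)) \/
             ((fun t => enorm (u i t w + u j t w)) @ \oo --> (0 : R))] in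
  measurable E /\ P E = 1%E.
Proof.
split.
- exact: measurable_sync.
- exact: probability_sync.
Qed.
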